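(* Wilf's conjecture is asymptotically true as the genus goes to infinity: for $g\ge 1$, let $n_g$ be the number of numerical semigroups of genus $g$ and let $w_g$ be the number of numerical semigroups $S$ of genus $g$ satisfying $e(S)\,|L(S)|\ge c(S)$. Then $\lim_{g\to\infty} w_g/n_g=1$.
   Context: $\mathbb{N}=\{0,1,2,\dots\}$. A numerical semigroup is a subset $S\subseteq\mathbb{N}$ closed under addition, containing $0$, with finite complement in $\mathbb{N}$. Its genus is $g(S)=|\mathbb{N}\setminus S|$ (for each $g$ there are finitely many numerical semigroups of genus $g$); its conductor is $c(S)=\max(\mathbb{N}\setminus S)+1$; $L(S)=\{s\in S : s<c(S)\}$; its embedding dimension $e(S)$ is the least number of elements generating $S$ as a semigroup (additive monoid). *)

(* Defs.v *)
From HB Require Import structures.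
From mathcomp Require Import all_boot all_order all_algebra finmap.
From mathcomp Require Import all_classical all_reals all_analysis.

Set Implicit Arguments.
Unset Strict Implicit.
Unset Printing Implicit Defensive.

Local Open Scope classical_set_scope.
Local Open Scope nat_scope.

Definition submonoid (M : set nat) : Prop :=
  M 0 /\ forall x y, M x -> M y -> M (x + y).

Definition numerical_semigroup (S : set nat) : Prop :=
  submonoid S /\ finite_set (~` S).

(* Number of elements of a finite set; the value is 0 on infinite sets, but
   every set to which it is applied below is finite. *)
Definition ncard (T : choiceType) (A : set T) : nat := #|` fset_set A|%fset.

Definition genus (S : set nat) : nat := ncard (~` S).

(* The maximum of x + 1 over the gaps x of S; it is 0 when S has no gap, in
   accordance with the convention that max of the empty set is -1. *)
Definition conductor (S : set nat) : nat :=
  \max_(x <- fset_set (~` S)) x.+1.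

Definition left_part (S : set nat) : set nat :=
  [set s | S s /\ s < conductor S].

Definition generates (A S : set nat) : Prop := smallest submonoid A = S.

Definition generating_sizes (S : set nat) : set nat :=
  [set k | exists A : {fset nat}, generates [set` A] S /\ #|` A|%fset = k].

(* The least element of generating_sizes S; the default value 0 of xget is
   never used for a numerical semigroup, as these are finitely generated. *)
Definition embedding_dim (S : set nat) : nat :=
  xget 0 [set k | generating_sizes S k /\
                  forall j, generating_sizes S j -> k <= j].

Definition semigroups_of_genus (g : nat) : set (set nat) :=
  [set S | numerical_semigroup S /\ genus S = g].

Definition satisfies_wilf (S : set nat) : Prop :=
  conductor S <= embedding_dim S * ncard (left_part S).

Definition num_semigroups (g : nat) : nat := ncard (semigroups_of_genus g).

Definition num_wilf_semigroups (g : nat) : nat :=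
  ncard [set S | semigroups_of_genus g S /\ satisfies_wilf S].

(* Main.v *)
(** A semigroup S of genus g has c <= 2g, so if it violates e * |L| >= c, then e or
   |L| is at most l = g / 48 as soon as (l + 1)^2 >= 2g.  Either S is recovered
   from its few elements below c = g + |L|, or from its few generators below 2g
   (all integers from 2g on belong to S).  Hence there are at most twice as
   many counterexamples as subsets of [0, 2g) with at most l elements, which is
   exponentially less than the 2^((g + 1) / 3) semigroups of genus g obtained
   by choosing one element from each of k pairs of consecutive integers. *)
Require Import Defs.
From mathcomp Require Import all_boot all_order all_algebra finmap zify.
From mathcomp Require Import all_classical all_reals all_analysis.
Import numFieldNormedType.Exports.

Set Implicit Arguments.
Unset Strict Implicit.
Unset Printing Implicit Defensive.

Local Open Scope classical_set_scope.
Local Open Scope nat_scope.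

(** * Cardinalities of finite sets *)

Lemma finite_set_mem (T : choiceType) (A : set T) (s : seq T) :
  (forall x, A x -> x \in s) -> finite_set A.
Proof. by move=> As; apply: (sub_finite_set _ (finite_seq s)). Qed.

Lemma ncard_le_size (T : choiceType) (A : set T) (s : seq T) :
  (forall x, A x -> x \in s) -> ncard A <= size s.
Proof.
move=> As; have finA := finite_set_mem As.
apply: uniq_leq_size => [|x]; first exact: fset_uniq.
by rewrite in_fset_set// inE => /As.
Qed.

Lemma size_le_ncard (T : choiceType) (A : set T) (s : seq T) :
  finite_set A -> uniq s -> (forall x, x \in s -> A x) -> size s <= ncard A.
Proof.
move=> finA s_uniq sA; apply: uniq_leq_size => // x /sA Ax.
by rewrite in_fset_set// inE.
Qed.

Lemma ncard_size (T : choiceType) (A : set T) (s : seq T) :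
  uniq s -> (forall x, A x <-> x \in s) -> ncard A = size s.
Proof.
move=> s_uniq As; apply/eqP; rewrite eqn_leq ncard_le_size => [|x /As//] /=.
apply: size_le_ncard => // [|x /As//].
by apply: (@finite_set_mem _ _ s) => x /As.
Qed.

Lemma ncard_count (A : set nat) n :
  (forall x, A x -> x < n) -> ncard A = count (fun x => `[<A x>]) (iota 0 n).
Proof.
move=> An; rewrite -size_filter; apply: ncard_size.
  exact: filter_uniq (iota_uniq _ _).
move=> x; rewrite mem_filter mem_iota add0n /=.
by split=> [Ax|/andP[/asboolP]//]; rewrite An// andbT; apply/asboolP.
Qed.

(** Subsets of ['I_n] form a finite type, so codes of this form can be enumerated and counted. *)
Definition trace n (A : set nat) : {set 'I_n} := [set i : 'I_n | `[<A i>]]%SET.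

Lemma card_trace_le n (A : set nat) : finite_set A -> #|trace n A| <= ncard A.
Proof.
move=> finA; rewrite cardE -(size_map val); apply: size_le_ncard => //.
  by rewrite (map_inj_uniq val_inj) enum_uniq.
by move=> x /mapP[i]; rewrite mem_enum inE => /asboolP Ai ->.
Qed.

Lemma card_trace n (A : set nat) :
  (forall x, A x -> x < n) -> #|trace n A| = ncard A.
Proof.
move=> An; rewrite cardE -(size_map val); apply/esym/ncard_size.
  by rewrite (map_inj_uniq val_inj) enum_uniq.
move=> x; split=> [Ax|/mapP[i]].
  apply/mapP; exists (Ordinal (An x Ax)) => //.
  by rewrite mem_enum inE; apply/asboolP.
by rewrite mem_enum inE => /asboolP Ai ->.
Qed.

(** * Conductor, genus and left part *)

Lemma conductorP (S : set nat) x :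
  numerical_semigroup S -> conductor S <= x -> S x.
Proof.
move=> [_ finS] cx; apply: contrapT => nSx.
suff: x.+1 <= conductor S by rewrite ltnNge cx.
by apply: leq_bigmax_seq => //; rewrite in_fset_set// inE.
Qed.

Lemma gap_conductor (S : set nat) :
  numerical_semigroup S -> 0 < conductor S -> ~ S (conductor S).-1.
Proof.
move=> [_ finS] c_gt0 Sf.
(* If [c - 1] were in [S], every gap [x] would satisfy [x + 1 <= c - 1], and so would the maximum
   [c]. *)
suff: conductor S <= (conductor S).-1 by rewrite leqNgt ltn_predL c_gt0.
rewrite {1}/conductor; apply/bigmax_leqP_seq => x.
rewrite in_fset_set// inE => nSx _.
have: x.+1 <= conductor S by apply: leq_bigmax_seq => //; rewrite in_fset_set// inE.
rewrite leq_eqVlt => /orP[/eqP xc|]; last by lia.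
by case: nSx; rewrite -[x]/(x.+1.-1) xc.
Qed.

Lemma genusE (S : set nat) : numerical_semigroup S ->
  genus S = count (fun x => ~~ `[<S x>]) (iota 0 (conductor S)).
Proof.
move=> semS; rewrite /genus (@ncard_count _ (conductor S)).
  by apply: eq_count => x; rewrite asbool_neg.
by move=> x nSx; rewrite ltnNge; apply/negP => /(conductorP semS).
Qed.

Lemma left_partE (S : set nat) :
  ncard (left_part S) = count (fun x => `[<S x>]) (iota 0 (conductor S)).
Proof.
rewrite (@ncard_count _ (conductor S)); last by move=> x [].
apply: eq_in_count => x; rewrite mem_iota add0n => /= xc.
by apply/asboolP/asboolP => [[]|].
Qed.

Lemma conductorE (S : set nat) : numerical_semigroup S ->
  conductor S = genus S + ncard (left_part S).
Proof.
move=> semS; rewrite genusE// left_partE addnC.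
by rewrite (count_predC (fun x => `[<S x>])) size_iota.
Qed.

(* Reflecting x to c - 1 - x sends elements of S below the conductor c to gaps,
   since c - 1 is itself a gap. *)
Lemma left_part_le_genus (S : set nat) :
  numerical_semigroup S -> ncard (left_part S) <= genus S.
Proof.
move=> semS; have [[_ addS] finS] := semS; set c := conductor S.
rewrite left_partE -size_filter -(size_map (fun x => c.-1 - x)).
apply: size_le_ncard => //.
  rewrite map_inj_in_uniq ?filter_uniq ?iota_uniq// => x y.
  by rewrite !mem_filter !mem_iota -/c; lia.
move=> _ /mapP[x + ->]; rewrite mem_filter mem_iota => /andP[/asboolP Sx xc] Sy.
apply: (@gap_conductor S) => //; first by lia.
by rewrite -/c -(@subnKC x c.-1); [apply: addS | lia].
Qed.

Lemma conductor_le (S : set nat) :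
  numerical_semigroup S -> conductor S <= 2 * genus S.
Proof.
by move=> semS; rewrite conductorE// mul2n -addnn leq_add2l left_part_le_genus.
Qed.

(** * Generators and embedding dimension *)

Lemma smallest_submonoidP (A : set nat) : submonoid (smallest submonoid A).
Proof.
split=> [M [[M0 _] _]//|x y Ax Ay M MA].
by case: (MA) => -[_ addM] _; apply: addM; [apply: Ax | apply: Ay].
Qed.

Lemma generating_sizes_neq0 (S : set nat) :
  numerical_semigroup S -> exists k, generating_sizes S k.
Proof.
move=> semS; have [monS _] := semS; set c := conductor S.
pose A := [fset x in [seq x <- iota 0 (2 * c).+2 | `[<S x>]]]%fset.
have memA x : x \in A = (x < (2 * c).+2) && `[<S x>].
  by rewrite !inE mem_filter mem_iota andbC.
exists #|` A|%fset, A; split=> //; apply/seteqP; split.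
  by apply: smallest_sub => // x /=; rewrite memA => /andP[_ /asboolP].
elim/ltn_ind => x IHx Sx.
have [x_small|x_large] := ltnP x (2 * c).+2.
  by apply: sub_gen_smallest => /=; rewrite memA x_small; apply/asboolP.
(* Both summands are at least [c]. Splitting off [c + 1] rather than [c] keeps the descent strict
   when [c = 0]. *)
have -> : x = c.+1 + (x - c.+1) by lia.
apply: (smallest_submonoidP _).2; apply: IHx; try lia.
- by apply: (conductorP semS); rewrite -/c; lia.
- by apply: (conductorP semS); rewrite -/c; lia.
Qed.

Lemma embedding_dimP (S : set nat) :
  numerical_semigroup S -> generating_sizes S (embedding_dim S).
Proof.
move=> /generating_sizes_neq0[k0 Sk0]; rewrite /embedding_dim.
have ex : exists k, `[<generating_sizes S k>] by exists k0; apply/asboolP.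
case: (ex_minnP ex) => k /asboolP Sk k_min.
have [|//] := @xgetPex _ 0 [set k | generating_sizes S k /\
  forall j, generating_sizes S j -> k <= j].
by exists k; split=> // j /asboolP; exact: k_min.
Qed.

(** * Recovering a semigroup from a finite code *)

Lemma smallest_submonoid_below (A : set nat) n x : x < n ->
  smallest submonoid A x -> smallest submonoid (A `&` [set y | y < n]) x.
Proof.
move=> xn Ax; set B := smallest submonoid _.
have [B0 addB] : submonoid B by exact: smallest_submonoidP.
(* This set is a submonoid because the summands of a number below [n] are themselves below [n]. *)
have: [set y | y < n -> B y] x; last exact.
apply: Ax; split=> [|y Ay yn]; last exact: sub_gen_smallest.
by split=> // y z By Bz yzn; apply: addB; [apply: By | apply: Bz]; lia.
Qed.

(* A semigroup of genus g contains [2g, oo), so it is recovered from its trace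
   on [0, 2g), from its left part, or from the trace of a generating set. *)
Definition of_trace n (A : {set 'I_n}) : set nat :=
  [set x | n <= x \/ exists2 i, i \in A & x = i :> nat].

(** By [conductorE], [g + #|A|] is the conductor when [A] is the trace of the left part, so the code
    need not record it. *)
Definition of_left_part g (A : {set 'I_(2 * g)}) : set nat :=
  [set x | g + #|A| <= x \/ exists2 i, i \in A & x = i :> nat].

Definition of_generators n (A : {set 'I_n}) : set nat :=
  [set x | n <= x \/ smallest submonoid [set y | exists2 i, i \in A & y = i :> nat] x].

Lemma of_traceK (S : set nat) : numerical_semigroup S ->
  of_trace (trace (2 * genus S) S) = S.
Proof.
move=> semS; apply/seteqP; split=> [x [gx|[i]]|x Sx].
- by apply: (conductorP semS); apply: leq_trans gx; exact: conductor_le.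
- by rewrite inE => /asboolP Si ->.
have [|xg] := leqP (2 * genus S) x; [by left | right].
by exists (Ordinal xg) => //; rewrite inE; apply/asboolP.
Qed.

Lemma of_left_partK (S : set nat) : numerical_semigroup S ->
  of_left_part (trace (2 * genus S) (left_part S)) = S.
Proof.
move=> semS; have c_le := @conductor_le S semS.
have lt_c x : left_part S x -> x < 2 * genus S by move=> [_]; lia.
rewrite /of_left_part card_trace// -conductorE//.
apply/seteqP; split=> [x [|[i]]|x Sx].
- exact: conductorP.
- by rewrite inE => /asboolP[Si _] ->.
have [|xc] := leqP (conductor S) x; [by left | right].
have Lx : left_part S x by [].
by exists (Ordinal (lt_c x Lx)) => //; rewrite inE; apply/asboolP.
Qed.

(** The generators lost in the trace are at least [2g]: they do not help to generate smaller
    elements, and [of_generators] adds all of [[2g, oo)] anyway. *)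
Lemma of_generatorsK (S A : set nat) : numerical_semigroup S -> generates A S ->
  of_generators (trace (2 * genus S) A) = S.
Proof.
move=> semS AS.
set n := 2 * genus S; have An : [set y | exists2 i, i \in trace n A & y = i :> nat] =
    A `&` [set y | y < n].
  apply/seteqP; split=> y [].
    by move=> i; rewrite inE => /asboolP Ai ->; split=> //=.
  by move=> Ay yn; exists (Ordinal yn) => //; rewrite inE; apply/asboolP.
rewrite /of_generators An; apply/seteqP; split=> [x [nx|]|x Sx].
- by apply: (conductorP semS); apply: leq_trans nx; exact: conductor_le.
- rewrite -AS; apply: smallest_sub; first exact: smallest_submonoidP.
  by move=> y [Ay _]; exact: sub_gen_smallest.
have [|xn] := leqP n x; [by left | right].
by apply: smallest_submonoid_below => //; rewrite AS.
Qed.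

Lemma finite_semigroups_of_genus g : finite_set (semigroups_of_genus g).
Proof.
apply: (@finite_set_mem _ _ [seq of_trace A | A : {set 'I_(2 * g)}]).
move=> S [semS gS]; rewrite -(of_traceK semS) gS.
by apply: map_f; rewrite mem_enum.
Qed.

(** * Upper bound for the number of counterexamples *)

Definition num_small_sets n l := #|[set A : {set 'I_n} | #|A| <= l]%SET|.

Lemma num_semigroups_le g l : 2 * g <= l.+1 ^ 2 ->
  num_semigroups g <= num_wilf_semigroups g + 2 * num_small_sets (2 * g) l.
Proof.
move=> gl; set W := [set S | semigroups_of_genus g S /\ satisfies_wilf S].
pose small := enum [set A : {set 'I_(2 * g)} | #|A| <= l]%SET.
have finW : finite_set W.
  by apply: sub_finite_set (finite_semigroups_of_genus g) => S [].
(* Three lists cover the semigroups of genus [g]; the last two may also contain other sets, which is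
   harmless for an upper bound. *)
have -> : num_wilf_semigroups g + 2 * num_small_sets (2 * g) l =
    size (fset_set W ++ map (@of_left_part g) small ++ map (@of_generators _) small).
  by rewrite !size_cat !size_map -cardE addnn -mul2n.
apply: ncard_le_size => S [semS gS]; rewrite !mem_cat.
have [wilfS|nwilfS] := pselect (satisfies_wilf S).
  by rewrite in_fset_set// mem_set.
have c_le := @conductor_le S semS; rewrite gS in c_le.
have [Ll|lL] := leqP (ncard (left_part S)) l.
  apply/or3P/Or32; rewrite -(of_left_partK semS) gS.
  apply: map_f; rewrite mem_enum inE; apply: leq_trans Ll.
  apply: card_trace_le; apply: (@finite_set_mem _ _ (iota 0 (conductor S))).
  by move=> x [_]; rewrite mem_iota.
(* Otherwise both factors exceed [l], and their product is at least [(l + 1)^2 >= 2g >= c]. *)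
have el : embedding_dim S <= l.
  rewrite leqNgt; apply/negP => le; apply: nwilfS.
  rewrite /satisfies_wilf; apply: leq_trans c_le (leq_trans gl _).
  by rewrite -mulnn leq_mul.
have [A [AS cardA]] := @embedding_dimP S semS.
apply/or3P/Or33; rewrite -(of_generatorsK semS AS) gS.
apply: map_f; rewrite mem_enum inE; apply: leq_trans el.
rewrite -cardA; apply: leq_trans (card_trace_le _ _) _; first exact: finite_fset.
by rewrite /ncard set_fsetK.
Qed.

Lemma num_small_setsE n l : num_small_sets n l = \sum_(j < l.+1) 'C(n, j).
Proof.
rewrite /num_small_sets -sum1_card.
(* Partition by cardinality; [inord] is faithful here because the sets counted have at most [l]
   elements. *)
rewrite (partition_big (fun A : {set 'I_n} => inord #|A| : 'I_l.+1) xpredT)//=.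
apply: eq_bigr => j _; rewrite sum1_card -[n in 'C(n, _)]card_ord -card_draws.
apply: eq_card => A; rewrite !inE unfold_in /= !inE.
apply/andP/eqP => [[Al /eqP <-]|Aj]; first by rewrite inordK.
by rewrite Aj -ltnS ltn_ord; split=> //; apply/eqP/val_inj; rewrite /= inordK.
Qed.

(* Compare with the binomial expansion of (d + 1)^n, whose terms of index at
   most l have a coefficient d^(n - j) >= d^(n - l). *)
Lemma num_small_sets_bound d n l : 0 < d -> l <= n ->
  num_small_sets n l * d ^ (n - l) <= d.+1 ^ n.
Proof.
move=> d_gt0 ln; rewrite num_small_setsE big_distrl /= -[d.+1]addn1 expnDn.
rewrite (big_ord_widen n.+1 (fun j => 'C(n, j) * d ^ (n - l))) ?ltnS//.
rewrite [X in X <= _]big_mkcond /=; apply: leq_sum => j _.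
case: ifP => // jl; rewrite exp1n muln1 leq_mul2l leq_pexp2l ?orbT//.
by rewrite leq_sub2l.
Qed.

(** The previous bound reads [((d + 1) / d)^n * d^l]. The first factor is at most [2^j], since ten
    factors [(d + 1) / d] cost at most [2]; the second is at most [2^(4l)]. *)
Lemma num_small_sets_pow d n l j :
  0 < d <= 2 ^ 4 -> d.+1 ^ 10 <= 2 * d ^ 10 -> l <= n <= 10 * j ->
  num_small_sets n l <= 2 ^ (j + 4 * l).
Proof.
move=> /andP[d_gt0 d16] d10 /andP[ln nj].
have exp_le a b e : a <= b -> a ^ e <= b ^ e.
  by case: e => // e ab; rewrite leq_exp2r.
have ratio_le : d.+1 ^ n <= 2 ^ j * d ^ n.
  have := exp_le _ _ j d10; rewrite expnMn -!expnM -(subnKC nj).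
  set u := 10 * j - n; rewrite !expnD mulnA => le_u.
  have u_gt0 : 0 < d ^ u by rewrite expn_gt0 d_gt0.
  rewrite -(leq_pmul2r u_gt0); apply: leq_trans le_u.
  by rewrite leq_mul2l exp_le ?orbT.
have := leq_trans (num_small_sets_bound d_gt0 ln) ratio_le.
have -> : d ^ n = d ^ l * d ^ (n - l) by rewrite -expnD subnKC.
rewrite mulnA leq_pmul2r ?expn_gt0 ?d_gt0// => /leq_trans; apply.
by rewrite expnD leq_mul2l expnM exp_le ?orbT.
Qed.

(* 15 and 48 are chosen to make (16/15)^(2g) * 15^(g/48) exponentially smaller
   than the lower bound 2^(g/3) for the number of semigroups. *)
Lemma num_small_sets_pow2 g :
  num_small_sets (2 * g) (g %/ 48) <= 2 ^ (2 * (g %/ 10).+1 + 4 * (g %/ 48)).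
Proof.
have base : 16 ^ 10 <= 2 * 15 ^ 10 by lia.
by apply: (num_small_sets_pow (d := 15) isT base); lia.
Qed.

(** * Lower bound for the number of semigroups *)

(* The set containing 0, everything from m + 2k on, and exactly one element of
   each of the k pairs {m + 2i, m + 2i + 1}, selected by the bit t_i. *)
Definition pair_choice m k (t : k.-tuple bool) : set nat :=
  [set x | x = 0 \/ m <= x /\
    (m + 2 * k <= x \/ odd (x - m) = nth false t (x - m)./2)].

(** Two nonzero elements have sum at least [2m >= m + 2k], where everything belongs to the set. *)
Lemma pair_choice_submonoid m k (t : k.-tuple bool) :
  2 * k <= m -> submonoid (pair_choice m t).
Proof.
move=> km; split=> [|x y]; first by left.
move=> [->|Sx] // [->|Sy]; first by rewrite addn0; right.
by have [mx _] := Sx; have [my _] := Sy; right; split; [lia | left; lia].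
Qed.

(** In each pair [2i, 2i + 1] exactly one parity differs from [b i]: this is the gap that
    [pair_choice] leaves in a pair. *)
Lemma count_odd_neq k (b : nat -> bool) :
  count (fun j => odd j != b j./2) (iota 0 (2 * k)) = k.
Proof.
elim: k => [|k IHk]; first by rewrite muln0.
rewrite mulnS addnC iotaD count_cat IHk add0n /= mul2n odd_double uphalf_double.
by rewrite doubleK; case: (b k); exact: addn1.
Qed.

Lemma gap_pair_choice m k (t : k.-tuple bool) x :
  (~` pair_choice m t) x -> x < m + 2 * k.
Proof.
by move=> nx; rewrite ltnNge; apply/negP => ?; apply: nx; right; split; [lia|left].
Qed.

Lemma genus_pair_choice m k (t : k.-tuple bool) :
  0 < m -> genus (pair_choice m t) = m.-1 + k.
Proof.
move=> m_gt0; rewrite /genus (ncard_count (@gap_pair_choice m k t)).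
rewrite iotaD count_cat; congr (_ + _).
  case: m m_gt0 => // m _ /=; rewrite asbool_neg asboolT /=; last by left.
  rewrite add0n -[RHS](size_iota 1); apply/eqP; rewrite -all_count.
  apply/allP => x; rewrite mem_iota => xm; apply/asboolP => -[|[]]; lia.
rewrite add0n -[m in iota m]addn0 iotaDl count_map -[RHS](count_odd_neq k (nth false t)).
apply: eq_in_count => j; rewrite mem_iota => /= jk.
rewrite asbool_neg; congr (~~ _); apply/asboolP/eqP; rewrite /pair_choice/= addKn.
  by move=> [|[_ []]//]; lia.
by move=> ?; right; split; [lia | right].
Qed.

Lemma pair_choice_inj m k : 0 < m -> injective (@pair_choice m k).
Proof.
move=> m_gt0 t t' tt'; apply: eq_from_tnth => i; have ik := ltn_ord i.
(* The bit of index [i] is read off from the membership of the first element of its pair. *)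
have in_choice (u : k.-tuple bool) : pair_choice m u (m + 2 * i) <-> tnth u i = false.
  rewrite /pair_choice /= addKn mul2n odd_double doubleK (tnth_nth false).
  split=> [[|[_ []]]|ui]; [lia|lia|by []|].
  by right; split; [lia | right].
apply/idP/idP; apply: contraTT => /negbTE.
  by move/in_choice; rewrite -tt' => /in_choice ->.
by move/in_choice; rewrite tt' => /in_choice ->.
Qed.

Lemma num_semigroups_ge g : 2 ^ (g.+1 %/ 3) <= num_semigroups g.
Proof.
(* Genus [g] forces [m + k = g + 1], and this [k] is the largest one with [2k <= m]. *)
set k := g.+1 %/ 3; set m := 2 * k + g.+1 %% 3.
have m_gt0 : 0 < m by rewrite /m /k; lia.
rewrite -card_bool -card_tuple cardE -(size_map (@pair_choice m k)).
apply: size_le_ncard; first exact: finite_semigroups_of_genus.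
  by rewrite (map_inj_uniq (pair_choice_inj m_gt0)) enum_uniq.
move=> _ /mapP[t _ ->]; split; last by rewrite genus_pair_choice// /m /k; lia.
split; first by apply: pair_choice_submonoid; rewrite /m; lia.
apply: (@finite_set_mem _ _ (iota 0 (m + 2 * k))) => x /gap_pair_choice.
by rewrite mem_iota.
Qed.

(** * Comparison of the bounds and the limit *)

Lemma num_wilf_semigroups_le g : num_wilf_semigroups g <= num_semigroups g.
Proof.
apply: ncard_le_size => S [semS _].
by rewrite in_fset_set ?mem_set//; exact: finite_semigroups_of_genus.
Qed.

(** The counterexamples have proportion at most [1920 / (g + 1)]; part of the exponential gap is
    spent on absorbing the factor [g + 1]. *)
Lemma num_non_wilf_le g : 48 * 96 <= g ->
  g.+1 * (num_semigroups g - num_wilf_semigroups g) <= 1920 * num_semigroups g.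
Proof.
move=> g_large; set N := num_small_sets (2 * g) (g %/ 48).
have le2N : num_semigroups g - num_wilf_semigroups g <= 2 * N.
  (* With [l = g %/ 48], [(l + 1)^2 >= (g / 48)^2 >= 2g] as soon as [g >= 2 * 48^2]. *)
  by rewrite leq_subLR num_semigroups_le// -mulnn; nia.
have g1 : g.+1 <= 60 * 2 ^ (3 * (g %/ 60)).
  have : 3 * (g %/ 60) < 2 ^ (3 * (g %/ 60)) by exact: ltn_expl.
  by lia.
have N_le : 2 * N <= 2 * 2 ^ (2 * (g %/ 10).+1 + 4 * (g %/ 48)).
  by rewrite leq_mul2l num_small_sets_pow2.
apply: leq_trans (leq_mul g1 (leq_trans le2N N_le)) _.
(* Without rounding, the exponents sum to [g/20 + g/5 + g/12 = g/3]; the factor [2^5] absorbs the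
   additive constants and the rounding. *)
have pow_le : 2 ^ (3 * (g %/ 60)) * (2 * 2 ^ (2 * (g %/ 10).+1 + 4 * (g %/ 48))) <=
    2 ^ 5 * num_semigroups g.
  apply: leq_trans (leq_mul (leqnn _) (num_semigroups_ge g)).
  by rewrite -expnS -!expnD leq_exp2l//; lia.
by rewrite -mulnA -[1920]/(60 * 2 ^ 5) -[leqRHS]mulnA leq_mul2l pow_le.
Qed.

Local Open Scope ring_scope.
Import GRing.Theory Num.Theory Order.TTheory.

Theorem mainTheorem2 (R : realType) :
  ((num_wilf_semigroups g)%:R / (num_semigroups g)%:R : R) @[g --> \oo] --> (1 : R).
Proof.
(* Since [harmonic g] is [1 / (g + 1)], the ratio is squeezed between this sequence and the constant
   [1]. *)
have lim1 : (1 - 1920 * harmonic g : R) @[g --> \oo] --> (1 : R).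
  rewrite -[X in _ --> X]subr0 -[X in _ - X](mulr0 1920).
  by apply: cvgB; [exact: cvg_cst | apply: cvgMr; exact: cvg_harmonic].
apply: (squeeze_cvgr _ lim1 (cvg_cst _)).
near=> g.
have n_gt0 : 0 < (num_semigroups g)%:R :> R.
  by rewrite ltr0n; apply: leq_trans (num_semigroups_ge g); rewrite expn_gt0.
have wn := num_wilf_semigroups_le g.
have g_large : (48 * 96 <= g)%N by near: g; exact: nbhs_infty_ge.
rewrite ler_pdivlMr// ler_pdivrMr// mul1r ler_nat wn andbT.
rewrite mulrBl mul1r lerBlDr -lerBlDl -natrB// /harmonic/=.
rewrite mulrAC ler_pdivlMr ?ltr0n// -!natrM ler_nat mulnC.
exact: num_non_wilf_le.
Unshelve. all: by end_near.
Qed.
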